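(* Let $a=\{a_n\}_{n\in\mathbb{N}}$ be a positive, non-increasing, summable sequence with $\sum_{n\ge1}a_n=1$. Suppose that $\lim_{n\to\infty}(s_n/s_{n+1})^{1/n}=1$, where $s_n=2^{-n}\sum_{i=2^n}^\infty a_i$. Then for all $\theta\in(0,1]$, $$\overline{\dim}_\theta C_a=\limsup_{n\to\infty}\frac{-\rho_{\theta,a}(n)\log 2}{\log s_{\rho_{\theta,a}(n)}}.$$
   Context: Intermediate dimensions. Write $|U|$ for the diameter of $U\subset\mathbb{R}$. For bounded $F\subseteq\mathbb{R}$ and $\theta\in(0,1]$, the upper $\theta$-intermediate dimension $\overline{\dim}_\theta F$ is the infimum of all $s\ge 0$ such that for every $\epsilon>0$ there exists $\delta_0>0$ such that for every $0<\delta\le\delta_0$ there is a cover $\{U_i\}_{i\in I}$ of $F$ with $\delta^{1/\theta}\le |U_i|\le \delta$ for all $i$ and $\sum_{i}|U_i|^s\le\epsilon$. The Cantor set $C_a$ associated with $a$ is constructed as follows. In the first step remove from $[0,1]$ an open interval of length $a_1$, leaving two closed intervals $I_{1,1}$ (left) and $I_{1,2}$ (right). After the $k$-th step there are $2^k$ closed intervals $I_{k,1},\dots,I_{k,2^k}$ (numbered from left to right); from each $I_{k,j}$ remove an open interval of length $a_{2^k+j-1}$ to obtain two closed intervals $I_{k+1,2j-1}$ and $I_{k+1,2j}$. The positions of the removed intervals are uniquely determined because the total removed length is $1$: the length of $I_{k,j}$ equals the sum of the lengths of all gaps subsequently removed from it, i.e. $|I_{k,j}|=\sum_{m\ge0}\sum_{i=0}^{2^m-1}a_{2^{k+m}+2^m(j-1)+i}$.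 Then $C_a=\bigcap_{k\ge1}\bigcup_{j=1}^{2^k}I_{k,j}$. The parameters. For $\theta\in(0,1]$ and an integer $r\ge1$, define $$\gamma_{\theta,a}(r)=\max\{m\in\mathbb{N}: s_m\ge s_r^{1/\theta}\},$$ and let $\rho_{\theta,a}(r)$ be the integer $m$ with $r\le m\le\gamma_{\theta,a}(r)+1$ for which $s_m^{1/m}$ is minimal (in case of ties any minimizer may be taken; the quotient in the theorem does not depend on the choice). *)

(* Defs.v *)
From mathcomp Require Import all_boot all_order all_algebra.
From mathcomp Require Import all_classical all_reals all_analysis.
Import Order.TTheory GRing.Theory Num.Theory.
Import numFieldNormedType.Exports.

Set Implicit Arguments.
Unset Strict Implicit.
Unset Printing Implicit Defensive.

Local Open Scope classical_set_scope.
Local Open Scope ring_scope.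

Section IntermediateDimension.
Variable R : realType.
Implicit Types (U F : set R) (theta s : R).

(* [sup] is 0 on empty and on unbounded sets. For unbounded sets this is a junk
   value, but it never matters below: the sets of an admissible cover have
   diameter at least [delta `^ theta^-1 > 0], which excludes this value. *)
Definition diam U : R := sup [set `|p.1 - p.2| | p in U `*` U].

(* The family is indexed by an arbitrary type; [esum] is the unordered sum. *)
Definition admissible_exponent theta F s : Prop :=
  forall eps : R, 0 < eps ->
  exists2 delta0 : R, 0 < delta0 &
  forall delta : R, 0 < delta <= delta0 ->
  exists (I : choiceType) (U : I -> set R),
    [/\ F `<=` \bigcup_i U i,
        forall i, delta `^ theta^-1 <= diam (U i) <= delta &
        (\esum_(i in [set: I]) (diam (U i) `^ s)%:E <= eps%:E)%E].

Definition upper_intermediate_dim theta F : \bar R :=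
  ereal_inf [set s%:E | s in [set s | 0 <= s /\ admissible_exponent theta F s]].

End IntermediateDimension.

(* Sequences [a] are indexed from 1: the value [a 0] is never used. *)
Section CantorSet.
Variables (R : realType) (a : nat -> R).

(* The intervals of level [k] are numbered from 0, so that the index [j] here
   stands for the interval I_{k,j+1}. *)
Definition interval_length (k j : nat) : R :=
  \big[+%R/0]_(0 <= m <oo)
    \sum_(0 <= i < 2 ^ m) a (2 ^ (k + m) + 2 ^ m * j + i)%N.

(* Endpoints of the closed intervals. Starting from [0, 1] at level 0, the
   parent of interval [j] of level [k + 1] is the interval [p = j./2] of level
   [k]; an open gap of length [a (2 ^ k + p)] is removed from it, right after
   its left child, which has index [p.*2]. *)
Fixpoint interval_ends (k j : nat) : R * R :=
  if k is k'.+1 then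
    let p := j./2 in
    let: (l, r) := interval_ends k' p in
    let l' := l + interval_length k p.*2 in
    if odd j then (l' + a (2 ^ k' + p)%N, r) else (l, l')
  else (0, 1).

Definition cantor_interval (k j : nat) : set R :=
  `[(interval_ends k j).1, (interval_ends k j).2]%classic.

Definition cantor_set : set R :=
  \bigcap_(k in [set k | (1 <= k)%N])
    \bigcup_(j in [set j | (j < 2 ^ k)%N]) cantor_interval k j.

End CantorSet.

Section ThetaRho.
Variables (R : realType) (theta : R) (a : nat -> R).

Definition tail_average (n : nat) : R :=
  2 ^- n * \big[+%R/0]_(2 ^ n <= i <oo) a i.

(* The largest element of the set; 0 if there is none. *)
Definition gamma (r : nat) : nat :=
  let A := [set m | tail_average r `^ theta^-1 <= tail_average m] in
  xget 0%N [set m | A m /\ forall k, A k -> (k <= m)%N].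

(* [m] is an admissible choice for rho(r), i.e., a minimizer of s_m^{1/m}. *)
Definition is_rho (r m : nat) : Prop :=
  let root k := tail_average k `^ k%:R^-1 in
  (r <= m <= (gamma r).+1)%N /\
  forall k, (r <= k <= (gamma r).+1)%N -> root m <= root k.

End ThetaRho.

(* Main.v *)
Require Import Defs.
From mathcomp Require Import all_boot all_order all_algebra.
From mathcomp Require Import all_classical all_reals all_analysis.
From mathcomp Require Import finmap zify ring lra.
Import Order.TTheory GRing.Theory Num.Theory.
Import numFieldNormedType.Exports.

Set Implicit Arguments.
Unset Strict Implicit.
Unset Printing Implicit Defensive.

Local Open Scope classical_set_scope.
Local Open Scope ring_scope.

(** Write s n for the tail average, that is, for the mean length of the 2 ^ n
    intervals of level n, and x n for ln (1 / s n) / n, so that the exponent in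
    the theorem is ln 2 / x (rho r) and rho r maximises x over the levels
    r, ..., gamma r + 1.

    Monotonicity of the gaps makes every interval of level k at least as long as
    every interval of level k + 1; hence each interval of level k + 1 has length
    between s (k + 2) and s k ([tail_le_interval_length],
    [interval_length_le_tail]). The ratio hypothesis says that s n / s (n + 1)
    is subexponential in n, whereas s n <= 2 ^ - n; so a shift of the level by a
    bounded amount changes s n by a factor that any positive power of s n
    absorbs. Up to such factors, the levels whose intervals have lengths between
    delta ^ (1 / theta) and delta = s r are exactly r, ..., gamma r + 1.

    Upper bound. Cover by the intervals of level m = rho r, enlarged to a
    common length that is admissible at scale delta. The cost at exponent t is
    about 2 ^ m * s m ^ t, which tends to 0 if ln 2 / x m stays below some
    number less than t ([cheap_covering_level], [admissible_of_scales]).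

    Lower bound. Suppose that ln 2 / x (rho r) exceeds some number greater than
    t. As rho r maximises x, the inequality 2 ^ - k <= s k ^ t holds, with room
    to spare, at all levels k of the window simultaneously
    ([mass_bound_on_scale_window]). A set U of admissible diameter has, for one
    of these k, a diameter below s (k + 1) but not much smaller than s k. So it
    meets at most two intervals of level k and carries a proportion at most
    2 * 2 ^ - k <= 2 * diam U ^ t of the natural measure. Only levels up to
    gamma r + 1 occur, so the measure can be replaced by counting the left
    endpoints of the intervals of that level ([count_left_ends]), and finitely
    many members of the cover are enough ([cover_cost_ge]). Summing up, every
    admissible cover costs at least 1 / 2. *)

(** * Lengths of the construction intervals *)

Lemma sum_nat_shift (V : nmodType) (p q : nat) (F : nat -> V) :
  \sum_(p <= i < p + q) F i = \sum_(0 <= i < q) F (p + i)%N.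
Proof.
rewrite -{1}[p]add0n big_addn addKn.
by apply: eq_bigr => i _; rewrite addnC.
Qed.

Section IntervalLengths.
Variables (R : realType) (a : nat -> R).
Hypothesis a_pos : forall n : nat, (1 <= n)%N -> 0 < a n.
Hypothesis a_noninc :
  forall m n : nat, (1 <= m)%N -> (m <= n)%N -> a n <= a m.
Hypothesis a_sum1 : (fun n : nat => \sum_(1 <= i < n) a i) @ \oo --> (1 : R).

Let L := interval_length a.
Let s := tail_average a.

(** The gaps removed from interval j of level k at step k + m; they are the
    terms of the series that defines its length. *)
Definition generation_gaps (k j m : nat) : R :=
  \sum_(0 <= i < 2 ^ m) a (2 ^ (k + m) + 2 ^ m * j + i)%N.

Definition partial_length (k j M : nat) : R :=
  \sum_(0 <= m < M) generation_gaps k j m.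

Lemma sum_gaps_ge0 m n : (1 <= m)%N -> 0 <= \sum_(m <= i < n) a i.
Proof.
move=> m_gt0; rewrite big_nat; apply: sumr_ge0 => i /andP[mi _].
by apply/ltW/a_pos/(leq_trans m_gt0).
Qed.

Lemma sum_gaps_tail n : (1 <= n)%N ->
  (fun N => \sum_(n <= i < N) a i) @ \oo --> \big[+%R/0]_(n <= i <oo) a i.
Proof.
move=> n_gt0; suff : cvgn (fun N => \sum_(n <= i < N) a i) by [].
apply/cvg_ex; exists (1 - \sum_(1 <= i < n) a i).
apply: (cvg_trans _ (cvgB a_sum1 (cvg_cst (\sum_(1 <= i < n) a i)))).
apply: near_eq_cvg; exists n => // N /= nN.
rewrite !fctE (@big_cat_nat _ _ _ n 1 N)//=.
by rewrite addrC addKr.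
Qed.

Lemma generation_gaps_ge0 k j m : 0 <= generation_gaps k j m.
Proof.
apply: sumr_ge0 => i _; apply/ltW/a_pos.
by rewrite -addnA (leq_trans _ (leq_addr _ _))// expn_gt0.
Qed.

Lemma partial_length_ge0 k j M : 0 <= partial_length k j M.
Proof. by apply: sumr_ge0 => m _; exact: generation_gaps_ge0. Qed.

(** The indices of the gaps of level k + m range over a full dyadic block, and
    those of level k + 1 + m lie in the next block; so the comparison already
    holds gap by gap. *)
Lemma le_partial_length_level k i j M : (j < 2 ^ k)%N ->
  partial_length k.+1 i M <= partial_length k j M.
Proof.
move=> jk; apply: ler_sum => m _; apply: ler_sum => l _; apply: a_noninc.
  by rewrite -addnA (leq_trans _ (leq_addr _ _))// expn_gt0.
rewrite leq_add2r (leq_trans _ (leq_addr _ _))// addSn expnS mul2n -addnn.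
by rewrite leq_add2l addnC expnD leq_mul2l ltnW ?orbT.
Qed.

(** Over all j, the gaps of one generation are exactly those with indices in
    one dyadic block. *)
Lemma sum_partial_length k M :
  \sum_(0 <= j < 2 ^ k) partial_length k j M =
  \sum_(2 ^ k <= i < 2 ^ (k + M)) a i.
Proof.
elim: M => [|M IH].
  rewrite addn0 [RHS]big_geq// big1// => j _.
  by rewrite /partial_length big_geq.
rewrite [RHS](@big_cat_nat _ _ _ (2 ^ (k + M)))//=; last 2 first.
- by rewrite leq_exp2l// leq_addr.
- by rewrite leq_exp2l// leq_add2l.
rewrite -IH; under eq_bigr do rewrite /partial_length big_nat_recr//=.
rewrite big_split/=; congr (_ + _).
rewrite addnS expnS mul2n -addnn [RHS]sum_nat_shift.
rewrite [X in _ = \sum_(0 <= _ < X) _]expnD big_nat_mul.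
apply: eq_bigr => j _; rewrite mulSn addnC [RHS]sum_nat_shift.
by apply: eq_bigr => i _; congr a; rewrite expnD; lia.
Qed.

Lemma partial_lengthS k j M : partial_length k j M.+1 =
  a (2 ^ k + j)%N + partial_length k.+1 j.*2 M + partial_length k.+1 j.*2.+1 M.
Proof.
rewrite /partial_length big_nat_recl//= -addrA -big_split/=; congr (_ + _).
  by rewrite /generation_gaps addn0 expn0 big_nat1 mul1n addn0.
apply: eq_bigr => m _; rewrite /generation_gaps.
rewrite (@big_cat_nat _ _ _ (2 ^ m))//=; last by rewrite leq_exp2l.
congr (_ + _).
  by apply: eq_bigr => i _; congr a; rewrite addnS addSn !expnS; lia.
rewrite expnS mul2n -addnn sum_nat_shift.
by apply: eq_bigr => i _; congr a; rewrite addnS addSn !expnS; lia.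
Qed.

Lemma sum_gaps_le1 n N : (1 <= n)%N -> \sum_(n <= i < N) a i <= 1.
Proof.
move=> n_gt0; apply: (@le_trans _ _ (\sum_(1 <= i < N) a i)).
  case: (leqP n N) => [nN|/ltnW Nn]; last by rewrite big_geq// sum_gaps_ge0.
  by rewrite [leRHS](@big_cat_nat _ _ _ n)//= lerDr sum_gaps_ge0.
rewrite -(cvg_lim _ a_sum1)//; apply: nondecreasing_cvgn_le; last first.
  by apply/cvg_ex; exists 1.
move=> p q pq; case: p pq => [|p] pq; first by rewrite big_geq// sum_gaps_ge0.
by rewrite [leRHS](@big_cat_nat _ _ _ p.+1)//= lerDl sum_gaps_ge0.
Qed.

(** The partial sums increase and are bounded by the total length 1. *)
Lemma partial_length_cvg k j : (j < 2 ^ k)%N ->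
  partial_length k j @ \oo --> L k j.
Proof.
move=> jk; suff : cvgn (partial_length k j) by [].
apply: nondecreasing_is_cvgn.
  move=> m n mn; rewrite [leRHS](@big_cat_nat _ _ _ m)//= lerDl.
  by apply: sumr_ge0 => i _; exact: generation_gaps_ge0.
exists 1 => _ [M _ <-].
have := sum_gaps_le1 (2 ^ (k + M)) (expn_gt0 2 k).
rewrite -sum_partial_length; apply: le_trans.
rewrite big_mkord (bigD1 (Ordinal jk))//= lerDl.
by apply: sumr_ge0 => i _; exact: partial_length_ge0.
Qed.

(** Right children inherit the right endpoint of their parent; this identity is
    what gives them the expected length. *)
Lemma interval_length_split k j : (j < 2 ^ k)%N ->
  L k j = L k.+1 j.*2 + a (2 ^ k + j)%N + L k.+1 j.*2.+1.
Proof.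
move=> jk; have [j0 j1] : (j.*2 < 2 ^ k.+1)%N /\ (j.*2.+1 < 2 ^ k.+1)%N.
  by rewrite expnS; lia.
have := partial_length_cvg jk; rewrite -cvg_shiftS => /cvg_unique.
apply => //=.
rewrite [X in X @ \oo](_ : _ = fun M => partial_length k.+1 j.*2 M +
  a (2 ^ k + j)%N + partial_length k.+1 j.*2.+1 M); last first.
  by apply/funext => M; rewrite partial_lengthS [X in X + _]addrC.
apply: cvgD; last exact: partial_length_cvg.
by apply: cvgD; [exact: partial_length_cvg|exact: cvg_cst].
Qed.

Lemma le_interval_length_level k i j :
  (i < 2 ^ k.+1)%N -> (j < 2 ^ k)%N -> L k.+1 i <= L k j.
Proof.
move=> ik jk; apply: (ler_cvg_to (partial_length_cvg ik)
  (partial_length_cvg jk)).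
by apply: nearW => M; exact: le_partial_length_level.
Qed.

(** So s k is the mean length at level k, and any bound that is uniform in the
    intervals of level k is a bound on s k. *)
Lemma sum_interval_length k :
  \sum_(0 <= j < 2 ^ k) L k j = 2 ^+ k * s k.
Proof.
rewrite /s /tail_average mulrA mulfV ?mul1r ?expf_neq0 ?pnatr_eq0//.
have c1 : (fun M => \sum_(0 <= j < 2 ^ k) partial_length k j M) @ \oo -->
    \sum_(0 <= j < 2 ^ k) L k j.
  rewrite big_mkord; under eq_fun do rewrite big_mkord.
  apply: cvg_big => [|j _]; first exact: add_continuous.
  exact: partial_length_cvg.
have c2 : (fun M => \sum_(0 <= j < 2 ^ k) partial_length k j M) @ \oo -->
    \big[+%R/0]_(2 ^ k <= i <oo) a i.
  under eq_fun do rewrite sum_partial_length.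
  apply: (cvg_comp (fun M => 2 ^ (k + M))%N _ _ (sum_gaps_tail (expn_gt0 2 k))).
  move=> P [N _ NP]; exists N => // M /= NM; apply: NP => /=.
  apply: (leq_trans NM); apply: (leq_trans (leq_addl k M)).
  by rewrite ltnW// ltn_expl.
exact: cvg_unique c1 c2.
Qed.

Lemma interval_length_le_tail k j :
  (j < 2 ^ k.+1)%N -> L k.+1 j <= s k.
Proof.
move=> jk; rewrite -(@ler_pM2l _ (2 ^+ k)) ?exprn_gt0//.
rewrite -sum_interval_length big_mkord.
rewrite -natrX mulr_natl -[X in _ *+ X]card_ord -sumr_const.
by apply: ler_sum => i _; exact: le_interval_length_level.
Qed.

Lemma tail_le_interval_length k j :
  (j < 2 ^ k)%N -> s k.+1 <= L k j.
Proof.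
move=> jk; rewrite -(@ler_pM2l _ (2 ^+ k.+1)) ?exprn_gt0//.
rewrite -sum_interval_length big_mkord.
rewrite -natrX mulr_natl -[X in _ *+ X]card_ord -sumr_const.
by apply: ler_sum => i _; exact: le_interval_length_level.
Qed.

Lemma tail_average_gt0 k : 0 < s k.
Proof.
rewrite mulr_gt0 ?invr_gt0 ?exprn_gt0//.
apply: (@lt_le_trans _ _ (a (2 ^ k)%N)); first by rewrite a_pos ?expn_gt0.
apply: limr_ge; first by apply: (sum_gaps_tail (expn_gt0 2 k)).
exists (2 ^ k).+1 => // N /= kN; rewrite big_ltn// lerDl.
by apply: sum_gaps_ge0.
Qed.

(** The factor 2 comes from the normalisation 2 ^ - k alone: the tail sums
    decrease. *)
Lemma tail_average_half k : 2 * s k.+1 <= s k.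
Proof.
rewrite /s /tail_average mulrA exprS invfM mulrA mulfV ?pnatr_eq0// mul1r.
rewrite ler_pM2l ?invr_gt0 ?exprn_gt0//.
apply: (ler_cvg_to (sum_gaps_tail (expn_gt0 2 k.+1))
  (sum_gaps_tail (expn_gt0 2 k))).
exists (2 ^ k.+1)%N => // N /= kN.
rewrite [leRHS](@big_cat_nat _ _ _ (2 ^ k.+1))//= ?leq_exp2l// lerDr.
by apply: sum_gaps_ge0; rewrite expn_gt0.
Qed.

Lemma tail_average0 : s 0 = 1.
Proof.
rewrite /s /tail_average expr0 invr1 mul1r expn0.
exact: cvg_lim a_sum1.
Qed.

Lemma interval_length00 : L 0 0 = 1.
Proof.
have := sum_interval_length 0.
by rewrite expn0 big_nat1 expr0 mul1r tail_average0.
Qed.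

End IntervalLengths.

(** * Positions of the construction intervals *)

Section IntervalPositions.
Variables (R : realType) (a : nat -> R).
Hypothesis a_pos : forall n : nat, (1 <= n)%N -> 0 < a n.
Hypothesis a_noninc :
  forall m n : nat, (1 <= m)%N -> (m <= n)%N -> a n <= a m.
Hypothesis a_sum1 : (fun n : nat => \sum_(1 <= i < n) a i) @ \oo --> (1 : R).

Let L := interval_length a.
Let s := tail_average a.
Let left k j := (interval_ends a k j).1.
Let right k j := (interval_ends a k j).2.

Lemma interval_ends_even k j :
  interval_ends a k.+1 j.*2 = (left k j, left k j + L k.+1 j.*2).
Proof.
by rewrite /left /L /= doubleK odd_double; case: interval_ends.
Qed.

Lemma interval_ends_odd k j : interval_ends a k.+1 j.*2.+1 =
  (left k j + L k.+1 j.*2 + a (2 ^ k + j)%N, right k j).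
Proof.
by rewrite /left /right /L /= uphalf_double odd_double; case: interval_ends.
Qed.

Lemma child_index k j : (j < 2 ^ k.+1)%N ->
  {i | (i < 2 ^ k)%N & j = i.*2 \/ j = i.*2.+1}.
Proof.
rewrite expnS => jk; exists j./2; first lia.
by have := odd_double_half j; case: odd => jE; [right|left]; rewrite -[LHS]jE.
Qed.

Lemma interval_length_gt0 k j : (j < 2 ^ k)%N -> 0 < L k j.
Proof.
move=> jk.
apply: lt_le_trans (tail_le_interval_length a_pos a_noninc a_sum1 jk).
exact: tail_average_gt0.
Qed.

Lemma right_endE k j : (j < 2 ^ k)%N -> right k j = left k j + L k j.
Proof.
elim: k j => [|k IH] j jk.
  have -> : j = 0%N by move: jk; rewrite expn0; lia.
  by rewrite /right /left /L interval_length00// add0r.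
have [i ik [->|->]] := child_index jk; rewrite /right /left.
  by rewrite interval_ends_even.
rewrite interval_ends_odd /= IH// /L interval_length_split//; lra.
Qed.

Lemma adjacent_intervals k j : (j.+1 < 2 ^ k)%N -> right k j <= left k j.+1.
Proof.
elim: k j => [|k IH] j jk; first by rewrite expn0 in jk.
have [i ik [jE|jE]] := child_index (ltnW jk); subst j; rewrite /right /left.
  rewrite interval_ends_even interval_ends_odd/= lerDl ltW// a_pos//.
  by rewrite addn_gt0 expn_gt0.
rewrite interval_ends_odd -doubleS interval_ends_even/=; apply: IH.
by move: jk; rewrite expnS; lia.
Qed.

Lemma parent_interval k j : (j < 2 ^ k.+1)%N ->
  left k j./2 <= left k.+1 j /\ right k.+1 j <= right k j./2.
Proof.
move=> jk; have [i ik jE] := child_index jk.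
have [L0 L1] : 0 < L k.+1 i.*2 /\ 0 < L k.+1 i.*2.+1.
  by split; apply: interval_length_gt0; rewrite expnS; lia.
have a0 : 0 < a (2 ^ k + i)%N by rewrite a_pos// addn_gt0 expn_gt0.
have rE := right_endE ik; rewrite /L interval_length_split// -/(L _ _) in rE.
case: jE => ->; rewrite ?doubleK /= ?uphalf_double /left /right.
  rewrite interval_ends_even/= -/(left _ _) -/(right _ _).
  by rewrite -[interval_length _ _ _]/(L _ _) in rE; split; lra.
rewrite interval_ends_odd/= -/(left _ _) -/(right _ _); split; lra.
Qed.

(** Quotient by 2 ^ d is d-fold passage to the parent. *)
Lemma ancestor_interval k d j : (j < 2 ^ (k + d))%N ->
  left k (j %/ 2 ^ d) <= left (k + d) j /\
  right (k + d) j <= right k (j %/ 2 ^ d).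
Proof.
elim: d j => [|d IH] j; first by rewrite addn0 divn1.
rewrite addnS => jk; have [l1 r1] := parent_interval jk.
have /IH[l2 r2] : (j./2 < 2 ^ (k + d))%N by move: jk; rewrite expnS; lia.
rewrite expnS divnMA divn2; split; first exact: le_trans l2 l1.
exact: le_trans r1 r2.
Qed.

(** Leftmost children share the left endpoint of their parent; this is why left
    endpoints are never removed. *)
Lemma left_end_descendant k d j : left (k + d) (j * 2 ^ d) = left k j.
Proof.
elim: d => [|d IH]; first by rewrite addn0 muln1.
rewrite addnS expnS mulnCA mul2n /left interval_ends_even/=; exact: IH.
Qed.

Lemma intervals_ordered k i j : (i < j)%N -> (j < 2 ^ k)%N ->
  right k i <= left k j.
Proof.
elim: j => // j IH; rewrite ltnS leq_eqVlt => /orP[/eqP->|ij] jk.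
  exact: adjacent_intervals.
apply: le_trans (IH ij (ltnW jk)) _.
apply: le_trans _ (adjacent_intervals jk).
by rewrite right_endE ?lerDl ?ltW// ?interval_length_gt0// ltnW.
Qed.

Lemma ancestor_index k d j : (j < 2 ^ (k + d))%N -> (j %/ 2 ^ d < 2 ^ k)%N.
Proof. by rewrite expnD => jk; rewrite ltn_divLR// expn_gt0. Qed.

Lemma left_end_in_cantor_set k j : (j < 2 ^ k)%N -> cantor_set a (left k j).
Proof.
move=> jk n _ /=; case: (leqP n k) => nk.
  have kE : (k = n + (k - n))%N by rewrite subnKC.
  rewrite kE in jk *; exists (j %/ 2 ^ (k - n))%N => /=.
    exact: ancestor_index.
  have [l1 r1] := ancestor_interval jk.
  rewrite /cantor_interval /= in_itv/= l1/= (le_trans _ r1)//.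
  by rewrite right_endE ?lerDl ?ltW// ?interval_length_gt0.
have nE : (n = k + (n - k))%N by rewrite subnKC// ltnW.
rewrite nE; exists (j * 2 ^ (n - k))%N => /=.
  by rewrite expnD ltn_mul2r jk expn_gt0.
have jk' : (j * 2 ^ (n - k) < 2 ^ (k + (n - k)))%N.
  by rewrite expnD ltn_mul2r jk expn_gt0.
rewrite /cantor_interval /= in_itv/= -/(left _ _) -/(right _ _).
rewrite right_endE// left_end_descendant lexx/= lerDl ltW//.
exact: interval_length_gt0.
Qed.

(** If the ancestors of level k of two intervals are not adjacent, then a whole
    interval of level k, of length at least s (k + 1), lies between them. *)
Lemma left_end_gap k d i j : (j < 2 ^ (k + d))%N ->
  ((i %/ 2 ^ d).+2 <= j %/ 2 ^ d)%N ->
  s k.+1 <= left (k + d) j - left (k + d) i.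
Proof.
move=> jk ij; have ik : (i < 2 ^ (k + d))%N.
  apply: leq_ltn_trans jk; apply: leq_trans (leq_trunc_div j (2 ^ d)).
  rewrite -ltnS (leq_trans (ltn_ceil i (expn_gt0 2 d)))//.
  by apply/leqW; rewrite leq_mul2r ltnW ?orbT.
have jK := ancestor_index jk.
have [_ r1] := ancestor_interval ik; have [l2 _] := ancestor_interval jk.
have r2 := right_endE ik; have L2 := interval_length_gt0 ik.
have mK := leq_ltn_trans ij jK; have mk := ltn_trans (ltnSn _) mK.
have r3 := adjacent_intervals mk; have r4 := right_endE mk.
have r5 := intervals_ordered ij jK.
have sL := tail_le_interval_length a_pos a_noninc a_sum1 mk.
rewrite -/(L _ _) -/(s _) in sL; lra.
Qed.

(** A set of diameter less than s (k + 1) meets at most two adjacent intervals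
    of level k, each of which has 2 ^ d descendants of level k + d. This plays
    the role of the mass distribution principle. *)
Lemma count_left_ends k d (U : set R) (w : R) : w < s k.+1 ->
  (forall x y, U x -> U y -> `|x - y| <= w) ->
  (#|[pred j : 'I_(2 ^ (k + d)) | `[< U (left (k + d) j) >]]| <= 2 * 2 ^ d)%N.
Proof.
move=> ws Uw; set A := [pred j | _].
have [i0 Ai0|A0] := pickP A; last by rewrite eq_card0.
case: (arg_minnP (fun i : 'I__ => nat_of_ord i) Ai0) => i Ai i_min.
(* With i the least index in the set, all indices lie below the end of the
   second block of length 2 ^ d, counted from the block of i. *)
rewrite cardE -(size_map val) -(size_iota (i %/ 2 ^ d * 2 ^ d) (2 * 2 ^ d)).
apply: uniq_leq_size.
  by rewrite map_inj_uniq ?enum_uniq//; exact: val_inj.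
move=> _ /mapP[j + ->]; rewrite mem_enum mem_iota => Aj.
have ij := i_min _ Aj; rewrite (leq_trans (leq_trunc_div i _) ij)/=.
rewrite -mulnDl addn2 ltnNge; apply/negP => jd.
have /(left_end_gap (ltn_ord j)) : ((i %/ 2 ^ d).+2 <= j %/ 2 ^ d)%N.
  by rewrite leq_divRL ?expn_gt0.
have /asboolP Ui : `[< U (left (k + d) i) >] := Ai.
have /asboolP Uj : `[< U (left (k + d) j) >] := Aj.
have := Uw _ _ Uj Ui; have := ler_norm (left (k + d) j - left (k + d) i); lra.
Qed.

End IntervalPositions.

(** * Comparison of levels and scales *)

Section Scales.
Variables (R : realType) (a : nat -> R).
Hypothesis a_pos : forall n : nat, (1 <= n)%N -> 0 < a n.
Hypothesis a_sum1 : (fun n : nat => \sum_(1 <= i < n) a i) @ \oo --> (1 : R).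
Hypothesis s_ratio : (fun n : nat =>
  (tail_average a n / tail_average a n.+1) `^ n%:R^-1) @ \oo --> (1 : R).

Let s := tail_average a.
Let s_gt0 n : 0 < s n := tail_average_gt0 a_pos a_sum1 n.

Lemma ln2_gt0 : 0 < ln 2 :> R.
Proof. by rewrite ln_gt0// ltr1n. Qed.

Lemma tail_average_ltS n : s n.+1 < s n.
Proof.
have := tail_average_half a_pos a_sum1 n; have := s_gt0 n.+1.
rewrite -/s; lra.
Qed.

Lemma tail_average_lt m n : (m < n)%N -> s n < s m.
Proof.
elim: n => // n IH; rewrite ltnS leq_eqVlt => /orP[/eqP->|/IH].
  exact: tail_average_ltS.
exact: lt_trans (tail_average_ltS n).
Qed.

Lemma tail_average_le m n : (m <= n)%N -> s n <= s m.
Proof. by rewrite leq_eqVlt => /orP[/eqP->//|/tail_average_lt/ltW]. Qed.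

Lemma tail_average_le1 n : s n <= 1.
Proof. by rewrite -(tail_average0 a_sum1); exact: tail_average_le. Qed.

Lemma ln_tail_average_le m n : (m <= n)%N -> ln (s n) <= ln (s m).
Proof. by move=> mn; rewrite ler_ln ?posrE//; exact: tail_average_le. Qed.

Lemma ln_tail_average_linear n : ln (s n) <= - (n%:R * ln 2).
Proof.
elim: n => [|n IH]; first by rewrite mul0r oppr0 /s tail_average0// ln1.
have : ln (2 * s n.+1) <= ln (s n).
  by rewrite ler_ln ?posrE//; [exact: (tail_average_half a_pos a_sum1 n)|
    exact: mulr_gt0].
rewrite lnM ?posrE// -natr1; move: IH; lra.
Qed.

Lemma tail_average_small e : 0 < e -> exists n, s n <= e.
Proof.
move=> e0; have [n] : exists n : nat, - ln e / ln 2 <= n%:R.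
  by exists (Num.truncn (- ln e / ln 2)).+1; rewrite ltW// truncnS_gt.
rewrite ler_pdivrMr ?ln2_gt0// => ne; exists n.
rewrite -ler_ln ?posrE//; have := ln_tail_average_linear n; lra.
Qed.

(** The ratio hypothesis in the form in which it is used: one step of the
    construction costs an arbitrarily small multiple of n in the logarithm. *)
Lemma ln_tail_average_growth e : 0 < e ->
  exists N, forall n, (N <= n)%N -> ln (s n) <= e * n%:R + ln (s n.+1).
Proof.
move=> e0; have e1 : 1 < expR e by rewrite expR_gt1.
have [N _ NP] := cvgr_lt _ s_ratio _ e1.
exists N.+1 => -[//|n] Nn; have := NP n.+1 (ltnW Nn) => /=; rewrite -/s.
have q0 : 0 < s n.+1 / s n.+2 by rewrite divr_gt0.
rewrite -ltr_ln ?posrE ?powR_gt0 ?expR_gt0// expRK ln_powR.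
rewrite mulrC ltr_pdivrMr ?ltr0n// lnM ?posrE ?invr_gt0// lnV ?posrE//; lra.
Qed.

Variable theta : R.
Hypothesis theta_01 : 0 < theta <= 1.

Lemma invr_theta_ge1 : 1 <= theta^-1.
Proof. by case/andP: theta_01 => t0 t1; rewrite invf_ge1. Qed.

(** The maximum in the definition of gamma exists, because s tends to 0. *)
Lemma gammaP r :
  theta^-1 * ln (s r) <= ln (s (gamma theta a r)) /\
  forall k, theta^-1 * ln (s r) <= ln (s k) -> (k <= gamma theta a r)%N.
Proof.
have AE k : (s r `^ theta^-1 <= s k) = (theta^-1 * ln (s r) <= ln (s k)).
  by rewrite -[LHS]ler_ln ?posrE ?powR_gt0// ln_powR.
pose P m := s r `^ theta^-1 <= s m.
have Pr : P r.
  rewrite /P AE -[leRHS]mul1r ler_wnM2r ?invr_theta_ge1//.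
  by rewrite ln_le0// tail_average_le1.
have [n sn] := tail_average_small (powR_gt0 theta^-1 (s_gt0 r)).
have Pn k : P k -> (k <= n)%N.
  rewrite leqNgt => Pk; apply/negP => /tail_average_lt; apply/negP.
  by rewrite -leNgt (le_trans sn).
have := @ex_maxnP P n (ex_intro _ r Pr) Pn => -[m Pm m_max].
rewrite /gamma; set B := [set m | _]; have Bm : B m by split.
have [Pg g_max] : B (xget 0%N B) by exact: xgetI Bm.
by split => [|k]; rewrite -AE => //; exact: g_max.
Qed.

Lemma le_gamma r : (r <= gamma theta a r)%N.
Proof.
apply: (gammaP r).2; rewrite -[leRHS]mul1r ler_wnM2r ?invr_theta_ge1//.
by rewrite ln_le0// tail_average_le1.
Qed.

Lemma ln_tail_gammaS r : ln (s (gamma theta a r).+1) < theta^-1 * ln (s r).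
Proof. by rewrite ltNge; apply/negP => /(gammaP r).2; rewrite ltnn. Qed.

Lemma ln_tail_average_lt0 n : (1 <= n)%N -> ln (s n) < 0.
Proof.
move=> n_gt0; apply: le_lt_trans (ln_tail_average_linear n) _.
by rewrite oppr_lt0 mulr_gt0 ?ltr0n// ln2_gt0.
Qed.

(** The n-th roots are compared after taking logarithms and clearing the
    denominators. For k = 0 both sides vanish, since s 0 = 1. *)
Lemma is_rho_ln r m k : (1 <= r)%N -> is_rho theta a r m ->
  (r <= k <= (gamma theta a r).+1)%N -> k%:R * ln (s m) <= m%:R * ln (s k).
Proof.
move=> r_gt0 [/andP[rm _] /[apply]] + /= => m_min.
have [->|k_gt0] := posnP k; first by rewrite mul0r /s tail_average0// ln1 mulr0.
have m_gt0 := leq_trans r_gt0 rm.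
rewrite -ler_ln ?posrE ?powR_gt0// !ln_powR in m_min; move: m_min.
rewrite ![_^-1 * _]mulrC ler_pdivrMr ?ltr0n// mulrAC ler_pdivlMr ?ltr0n//.
by rewrite ![_%:R * _]mulrC.
Qed.

Variables (rho : nat -> nat).
Hypothesis rhoP : forall r : nat, (1 <= r)%N -> is_rho theta a r (rho r).

Let exponent n := - (rho n)%:R * ln 2 / ln (s (rho n)).

Lemma rho_gt0 r : (1 <= r)%N -> (1 <= rho r)%N.
Proof. by move=> r0; have [/andP[/(leq_trans r0)]] := rhoP r0. Qed.

Lemma exponent_le r x : (1 <= r)%N ->
  (exponent r <= x) = ((rho r)%:R * ln 2 <= - (x * ln (s (rho r)))).
Proof.
move=> r0; rewrite /exponent ler_ndivrMr; last first.
  by apply/ln_tail_average_lt0/rho_gt0.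
by rewrite mulNr lerNr.
Qed.

(** With q such that s (q + 1) <= delta < s q, the level m + 1 is rho (q + 2)
    and D is the larger of s m and delta ^ (1 / theta): the former is needed
    to cover the intervals of level m + 1, the latter to be admissible.
    As m + 1 <= gamma (q + 2) + 1, both are at most
    s (m + 1) * exp (K e (m + 1)) for a small e, while
    2 ^ (m + 1) * s (m + 1) ^ t <= s (m + 1) ^ (t - x) is at most
    2 ^ - ((t - x) (m + 1)). *)
Lemma cheap_covering_level (t x : R) (N : nat) (eps : R) :
  0 <= t -> x < t -> 0 < eps ->
  (forall n, (N <= n)%N -> exponent n <= x) ->
  exists2 delta0 : R, 0 < delta0 & forall delta, 0 < delta <= delta0 ->
  exists m D, [/\ s m <= D, delta `^ theta^-1 <= D, D <= delta &
    (2 ^ m.+1)%:R * D `^ t <= eps].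
Proof.
move=> t_ge0 xt eps_gt0 Nx; have l2 := ln2_gt0; have th := invr_theta_ge1.
(* Two steps, from q to q + 2, magnified by 1 / theta, and one step near m. *)
pose K := 2 * theta^-1 + 1; have K0 : 0 < K by rewrite /K; lra.
(* The cost decays like exp (- 2 c (m + 1)); the error e is chosen so that at
   most half of this exponent is lost. *)
pose c := (t - x) * ln 2 / 2.
have c0 : 0 < c by rewrite /c divr_gt0 ?mulr_gt0// subr_gt0.
have tK0 : 0 < t * K + 1 by rewrite ltr_wpDl// mulr_ge0// ltW.
pose e := c / (t * K + 1); have e0 : 0 < e by rewrite divr_gt0.
have tKe : t * K * e <= c.
  by rewrite /e mulrA ler_pdivrMr// [t * K * c]mulrC ler_wpM2l ?lerDl// ltW.
have [N1 growth] := ln_tail_average_growth e0.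
have [Q0 Q0P] : exists Q0 : nat, - ln eps <= c * Q0%:R.
  exists (Num.truncn (- ln eps / c)).+1.
  by rewrite mulrC -ler_pdivrMr// ltW// truncnS_gt.
have [Q [Q0Q NQ N1Q]] : exists Q, [/\ Q0 <= Q, N <= Q & N1 <= Q]%N.
  by exists (maxn Q0 (maxn N N1)); rewrite !leq_max !leqnn !orbT.
exists (s Q.+1) => // delta /andP[d0 dQ].
have exP : exists p, s p <= delta by exact: tail_average_small.
case: (ex_minnP exP) => -[|q].
  move=> s0d.
  have := le_lt_trans (le_trans s0d dQ) (tail_average_lt (ltn0Sn Q)).
  by rewrite ltxx.
move=> sq q_min.
have qQ : (Q <= q)%N.
  rewrite -ltnS ltnNge; apply/negP => /tail_average_le qQ.
  by have := tail_average_ltS Q; rewrite ltNge (le_trans qQ)// (le_trans sq).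
have dq : delta < s q.
  by rewrite ltNge; apply/negP => /q_min; rewrite ltnn.
pose r := q.+2; have [/andP[rm mg] _] := rhoP (ltn0Sn _ : (1 <= r)%N).
have [m mE] : exists m, rho r = m.+1.
  by exists (rho r).-1; rewrite prednK// rho_gt0.
have xm : exponent r <= x by apply: Nx; rewrite !leqW// (leq_trans NQ).
have ld : ln delta <= ln (s q) by rewrite ler_ln ?posrE// ltW.
have : delta <= 1 by rewrite (le_trans (ltW dq))// tail_average_le1.
rewrite exponent_le// in xm; rewrite mE in xm rm mg.
have mr : (q < m)%N by [].
have N1q := leq_trans N1Q qQ.
pose D := Num.max (s m) (delta `^ theta^-1).
have D0 : 0 < D by rewrite lt_max s_gt0.
move=> d1; exists m, D; split.
- by rewrite le_max lexx.
- by rewrite le_max lexx orbT.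
- rewrite ge_max (le_trans (tail_average_le mr))//=.
  by apply: ge1r_powR => //; rewrite d0.
have lD : ln D <= ln (s m.+1) + K * e * m.+1%:R.
  have eK : e <= K * e by rewrite ler_peMl ?(ltW e0)// /K; lra.
  rewrite /D; case: (leP (s m)) => _.
    rewrite ln_powR.
    have h1 : ln (s q) <= 2 * e * m.+1%:R + ln (s r).
      have g1 : ln (s q) <= e * q%:R + ln (s q.+1) by exact: growth.
      have g2 : ln (s q.+1) <= e * q.+1%:R + ln (s r).
        by apply: growth; exact: leqW.
      have : e * q%:R <= e * m.+1%:R.
        by rewrite ler_wpM2l ?(ltW e0)// ler_nat ltnW// ltnW.
      have : e * q.+1%:R <= e * m.+1%:R.
        by rewrite ler_wpM2l ?(ltW e0)// ler_nat ltnW.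
      lra.
    have h2 : theta^-1 * ln delta <= theta^-1 * (2 * e * m.+1%:R + ln (s r)).
      by rewrite ler_wpM2l ?(le_trans ld)//; lra.
    have [h3 _] := gammaP r.
    have h4 : ln (s (gamma theta a r)) <= e * m.+1%:R + ln (s m.+1).
      move: mg; rewrite leq_eqVlt => /orP[/eqP[mg]|mg].
        have : ln (s m) <= e * m%:R + ln (s m.+1).
          by apply/growth/(leq_trans N1q (ltnW mr)).
        have : e * m%:R <= e * m.+1%:R by rewrite ler_wpM2l ?(ltW e0)// ler_nat.
        by rewrite -mg; lra.
      apply: (le_trans (ln_tail_average_le (mg : (m.+1 <= _)%N))).
      by rewrite lerDr mulr_ge0// ltW.
    rewrite /K; lra.
  have : ln (s m) <= e * m%:R + ln (s m.+1).
    by apply/growth/(leq_trans N1q (ltnW mr)).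
  have : e * m%:R <= e * m.+1%:R by rewrite ler_wpM2l ?(ltW e0)// ler_nat.
  have : e * m.+1%:R <= K * e * m.+1%:R by rewrite ler_wpM2r.
  lra.
rewrite -ler_ln ?posrE ?powR_gt0//; last first.
  by rewrite mulr_gt0 ?powR_gt0// ltr0n expn_gt0.
rewrite lnM ?posrE ?powR_gt0// ?ltr0n ?expn_gt0//.
rewrite ln_powR natrX lnXn// -[ln 2 *+ _]mulr_natl.
have h1 : t * ln D <= t * (ln (s m.+1) + K * e * m.+1%:R) by rewrite ler_wpM2l.
have h2 : t * K * e * m.+1%:R <= c * m.+1%:R by rewrite ler_wpM2r.
have h3 : (t - x) * ln (s m.+1) <= (t - x) * - (m.+1%:R * ln 2).
  by rewrite ler_wpM2l ?ln_tail_average_linear// subr_ge0 ltW.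
have h4 : c * Q0%:R <= c * m.+1%:R.
  rewrite ler_wpM2l ?(ltW c0)// ler_nat (leq_trans Q0Q (leq_trans qQ _))//.
  by rewrite leqW// ltnW.
have h5 : 2 * (c * m.+1%:R) = (t - x) * (m.+1%:R * ln 2) by rewrite /c; field.
lra.
Qed.

(** The scale is delta = s (r + 2), so that d <= delta forces a level k >= r
    with d < s (k + 1). For d between s (k + 2) and s (k + 1), comparing d with
    s k costs two steps. If d < s (gamma r + 2), the level gamma r + 1 is
    used instead: there s is below s r ^ (1 / theta), which exceeds
    delta ^ (1 / theta) <= d only by a subexponential factor. *)
Lemma mass_bound_on_scale_window (t x : R) : 0 <= t -> t < x ->
  (forall N, exists2 n, (N <= n)%N & x < exponent n) ->
  forall delta0, 0 < delta0 -> exists delta G, 0 < delta <= delta0 /\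
  forall d, delta `^ theta^-1 <= d <= delta ->
  exists k, [/\ (k <= G)%N, d < s k.+1 & 2 ^- k <= d `^ t].
Proof.
move=> t_ge0 tx often delta0 delta0_gt0.
have l2 := ln2_gt0; have th := invr_theta_ge1.
pose K := 3 * theta^-1; have K3 : 3 <= K by rewrite /K; lra.
pose c := (x - t) * ln 2; have c0 : 0 < c by rewrite mulr_gt0// subr_gt0.
have tK0 : 0 < t * K + 1 by rewrite ltr_wpDl// mulr_ge0//; lra.
pose e := c / (t * K + 1); have e0 : 0 < e by rewrite divr_gt0.
have tKe : t * K * e <= c.
  by rewrite /e mulrA ler_pdivrMr// [t * K * c]mulrC ler_wpM2l ?lerDl// ltW.
have [N1 growth] := ln_tail_average_growth e0.
have [Q sQ] := tail_average_small delta0_gt0.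
have [r] := often (maxn 1 (maxn Q N1)).
rewrite !geq_max => /and3P[r0 Qr N1r].
rewrite ltNge exponent_le// -ltNge => xr.
(* The minimality of rho r transfers its exponent to the whole window. *)
have rk k : (r <= k <= (gamma theta a r).+1)%N ->
    - (x * ln (s k)) <= k%:R * ln 2.
  move=> krg; have h := is_rho_ln r0 (rhoP r0) krg.
  have m0 : 0 < (rho r)%:R :> R by rewrite ltr0n rho_gt0.
  rewrite -(ler_pM2l m0).
  have x0 : 0 <= x by lra.
  have := ler_wpM2l x0 h; have := ler_wpM2l (ler0n R k) (ltW xr); lra.
have two_steps k : (r <= k)%N -> ln (s k) <= 3 * e * k%:R + ln (s k.+2).
  move=> kr; have g1 : ln (s k) <= e * k%:R + ln (s k.+1).
    by apply/growth/(leq_trans N1r).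
  have g2 : ln (s k.+1) <= e * k.+1%:R + ln (s k.+2).
    by apply/growth/(leq_trans N1r)/leqW.
  have : e * 1 <= e * k%:R.
    by rewrite ler_wpM2l ?(ltW e0)// ler1n (leq_trans r0).
  move: g2; rewrite -natr1; lra.
exists (s r.+2), (gamma theta a r).+1; split.
  by rewrite s_gt0/= (le_trans _ sQ)// tail_average_le// !leqW.
move=> d /andP[dl dr].
have d0 : 0 < d by apply: lt_le_trans dl; rewrite powR_gt0.
(* The bound 2 ^ - k <= s k ^ x, valid on the whole window, pays for the
   replacement of s k by d, because x - t > 0. *)
suff [k [rkg dk sk]] : exists k, [/\ (r <= k <= (gamma theta a r).+1)%N,
    d < s k.+1 & ln (s k) <= K * e * k%:R + ln d].
  exists k; split => //; first by case/andP: rkg.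
  rewrite -ler_ln ?posrE ?invr_gt0 ?exprn_gt0 ?powR_gt0//.
  rewrite ln_powR lnV ?posrE ?exprn_gt0// lnXn// -[ln 2 *+ _]mulr_natl.
  have h1 := rk k rkg.
  have h2 := ler_wpM2l t_ge0 sk.
  have h3 : t * K * e * k%:R <= c * k%:R by rewrite ler_wpM2r.
  have xt0 : 0 <= x - t by lra.
  have h4 := ler_wpM2l xt0 (ln_tail_average_linear k).
  have h5 : c * k%:R = (x - t) * (k%:R * ln 2) by rewrite /c; ring.
  lra.
have rg := le_gamma r.
case: (ltP d (s (gamma theta a r).+2)) => [dG|Gd].
  exists (gamma theta a r).+1; split => //; first by rewrite leqnn andbT leqW.
  have h1 := ln_tail_gammaS r.
  have th0 : 0 <= theta^-1 by lra.
  have h2 := ler_wpM2l th0 (two_steps r (leqnn r)).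
  have h3 : theta^-1 * ln (s r.+2) <= ln d.
    by rewrite -ln_powR ler_ln ?posrE ?powR_gt0.
  have h4 : K * e * r%:R <= K * e * (gamma theta a r).+1%:R.
    by rewrite ler_wpM2l ?ler_nat ?leqW// mulr_ge0 ?(ltW e0)//; lra.
  have h5 : K * e * r%:R = theta^-1 * (3 * e * r%:R) by rewrite /K; ring.
  lra.
have exP : exists p, s p.+1 <= d by exists (gamma theta a r).+1.
case: (ex_minnP exP) => p pd p_min.
have rp : (r < p)%N.
  rewrite ltnNge; apply/negP => pr.
  have : s r.+2 < s p.+1 by apply: tail_average_lt; rewrite !ltnS.
  by rewrite ltNge (le_trans pd).
case: p => // k in pd p_min rp *.
exists k; split.
- by rewrite (rp : (r <= k)%N)/= ltnW// p_min.
- by rewrite ltNge; apply/negP => /p_min; rewrite ltnn.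
- apply: (le_trans (two_steps k _)); first by [].
  apply: lerD; last by rewrite ler_ln ?posrE.
  by rewrite !ler_wpM2r// ltW.
Qed.

End Scales.

(** * Diameters and costs of covers *)

Section CoverLemmas.
Variable R : realType.

Lemma diam_segment (x D : R) : 0 <= D -> diam `[x, x + D]%classic = D.
Proof.
move=> D0; apply/eqP; rewrite eq_le; apply/andP; split.
  apply: ge_sup.
    by exists `|x - x|, (x, x) => //=; rewrite in_itv/= lexx lerDl D0.
  move=> _ [[y z] /= [+ +] <-]; rewrite !in_itv/= => /andP[y1 y2] /andP[z1 z2].
  rewrite ler_norml; lra.
apply: ub_le_sup.
  exists D => _ [[y z] /= [+ +] <-].
  rewrite !in_itv/= => /andP[y1 y2] /andP[z1 z2].
  rewrite ler_norml; lra.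
exists (x + D, x) => /=; first by rewrite !in_itv/= !lexx lerDl D0.
by rewrite addrC addKr ger0_norm.
Qed.

(** Positivity of the diameter excludes the sets with unbounded distances, whose
    supremum is 0 by convention. *)
Lemma dist_le_diam (U : set R) x y : 0 < diam U -> U x -> U y ->
  `|x - y| <= diam U.
Proof.
move=> U0 Ux Uy; apply: ub_le_sup; last by exists (x, y).
by apply: contrapT => h; move: U0; rewrite /diam sup_out ?ltxx// => -[].
Qed.

Lemma esum_const_ord (n : nat) (x : R) : 0 <= x ->
  (\esum_(i in [set: 'I_n]) x%:E)%E = (n%:R * x)%:E.
Proof.
move=> x0; rewrite esum_fset; first last.
- by move=> i _; rewrite lee_fin.
- exact: finite_finset.
rewrite -set_true -(bigfs _ (index_enum_uniq 'I_n))//=; last first.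
  by move=> i _; rewrite mem_index_enum.
by rewrite sumEFin sumr_const card_ord mulr_natl.
Qed.

(** A finite subfamily costs at most as much as the whole family, whatever the
    index type. *)
Lemma fsum_le_esum (I : choiceType) (X : set I) (f : I -> R) (eps : R) :
  finite_set X -> (\esum_(i in [set: I]) (f i)%:E <= eps%:E)%E ->
  \sum_(i <- fset_set X) f i <= eps.
Proof.
move=> finX h; rewrite -lee_fin -sumEFin.
apply: le_trans h; apply: esum_ge; exists X; first by split.
by rewrite fsbig_finite.
Qed.

End CoverLemmas.

(** * Covers of the Cantor set *)

Section IntermediateDimensionBounds.
Variables (R : realType) (a : nat -> R).
Hypothesis a_pos : forall n : nat, (1 <= n)%N -> 0 < a n.
Hypothesis a_noninc :
  forall m n : nat, (1 <= m)%N -> (m <= n)%N -> a n <= a m.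
Hypothesis a_sum1 : (fun n : nat => \sum_(1 <= i < n) a i) @ \oo --> (1 : R).

Let s := tail_average a.
Let left k j := (interval_ends a k j).1.

Lemma cantor_set_sub_segments m (D : R) : s m <= D ->
  cantor_set a `<=`
  \bigcup_(i in [set: 'I_(2 ^ m.+1)]) `[left m.+1 i, left m.+1 i + D]%classic.
Proof.
move=> sD x /(_ m.+1 (ltn0Sn m))[j /= jm]; rewrite /cantor_interval /= in_itv/=.
rewrite (right_endE a_pos a_sum1 jm) => /andP[lx xr].
exists (Ordinal jm) => //=; rewrite in_itv/= lx/=; apply: (le_trans xr).
rewrite lerD2l; apply: le_trans sD; exact: interval_length_le_tail.
Qed.

Lemma admissible_of_scales (theta t : R) :
  (forall eps, 0 < eps -> exists2 delta0 : R, 0 < delta0 &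
    forall delta, 0 < delta <= delta0 -> exists m D,
    [/\ s m <= D, delta `^ theta^-1 <= D, D <= delta &
      (2 ^ m.+1)%:R * D `^ t <= eps]) ->
  admissible_exponent theta (cantor_set a) t.
Proof.
move=> scales eps /scales[delta0 delta0_gt0 small]; exists delta0 => // delta.
move=> /small[m [D [sD dD Dd cost]]].
have D0 : 0 <= D by apply: le_trans dD; exact: powR_ge0.
exists 'I_(2 ^ m.+1), (fun i : 'I__ => `[left m.+1 i, left m.+1 i + D]%classic).
split; first exact: cantor_set_sub_segments.
  by move=> i; rewrite diam_segment// dD Dd.
under eq_esum do rewrite diam_segment//.
by rewrite esum_const_ord ?powR_ge0// lee_fin.
Qed.

(** Each of the 2 ^ G left endpoints of level G is assigned a set of the cover
    that contains it. The sets chosen are finite in number, and U contains at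
    most 2 * 2 ^ (G - k) <= 2 * 2 ^ G * diam U ^ t of these endpoints, so that
    2 ^ G <= 2 * 2 ^ G * (cost). *)
Lemma cover_cost_ge (theta t delta : R) G (I : choiceType) (U : I -> set R)
    (eps : R) :
  0 < delta ->
  (forall d, delta `^ theta^-1 <= d <= delta ->
    exists k, [/\ (k <= G)%N, d < s k.+1 & 2 ^- k <= d `^ t]) ->
  cantor_set a `<=` \bigcup_i U i ->
  (forall i, delta `^ theta^-1 <= diam (U i) <= delta) ->
  (\esum_(i in [set: I]) (diam (U i) `^ t)%:E <= eps%:E)%E -> 2^-1 <= eps.
Proof.
move=> d0 scales cover diamU cost.
have /choice[f fP] (j : 'I_(2 ^ G)) : exists i, U i (left G j).
  have [i _ Ui] := cover _
    (left_end_in_cantor_set a_pos a_noninc a_sum1 (ltn_ord j)).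
  by exists i.
pose X := range f; have finX : finite_set X by exact: finite_image.
apply: le_trans (fsum_le_esum finX cost).
pose c i := #|[pred j : 'I_(2 ^ G) | `[< U i (left G j) >]]|.
have cU i : (c i)%:R <= 2 * 2 ^+ G * diam (U i) `^ t.
  have [k [kG Uk sk]] := scales _ (diamU i).
  have U0 : 0 < diam (U i).
    by case/andP: (diamU i) => + _; apply: lt_le_trans; rewrite powR_gt0.
  have := @count_left_ends _ _ a_pos a_noninc a_sum1 k (G - k) (U i) _ Uk
    (fun x y => dist_le_diam U0).
  rewrite subnKC// -/(c i) -(ler_nat R) => /le_trans; apply.
  rewrite natrM natrX -mulrA ler_pM2l// -[in leRHS](subnKC kG) exprD.
  rewrite -mulrA [leLHS](_ : _ = 2 ^+ k * (2 ^+ (G - k) * 2 ^- k)); last first.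
    by rewrite mulrCA divff ?mulr1// expf_neq0.
  by rewrite ler_pM2l ?exprn_gt0// ler_pM2l ?exprn_gt0.
have : (2 ^ G <= \sum_(i <- fset_set X) c i)%N.
  under eq_bigr do rewrite /c -sum1_card big_mkcond/=.
  (* Double counting of the pairs of an endpoint and a chosen set. *)
  rewrite exchange_big/= -[X in (X <= _)%N]card_ord -sum1_card.
  apply: leq_sum => j _; rewrite (big_rem (f j))/=; last first.
    by rewrite in_fset_set//; apply/mem_set; exists j.
  by rewrite inE/= asboolT ?leq_addr.
rewrite -(ler_nat R) natr_sum natrX => h.
have G0 : 0 < 2 ^+ G :> R by rewrite exprn_gt0.
have : 2 ^+ G <= 2 * 2 ^+ G * \sum_(i <- fset_set X) diam (U i) `^ t.
  by apply: (le_trans h); rewrite mulr_sumr; apply: ler_sum.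
rewrite -[leLHS]mulr1 [2 * _]mulrC -mulrA ler_pM2l// => h'.
by rewrite -(@ler_pM2l _ 2)// divff.
Qed.

Lemma not_admissible_of_scales (theta t : R) :
  (forall delta0 : R, 0 < delta0 -> exists delta G, 0 < delta <= delta0 /\
    forall d, delta `^ theta^-1 <= d <= delta ->
    exists k, [/\ (k <= G)%N, d < s k.+1 & 2 ^- k <= d `^ t]) ->
  ~ admissible_exponent theta (cantor_set a) t.
Proof.
move=> scales /(_ 4^-1 _)[|delta0 /scales[delta [G [ddelta0 scale]]]].
  by rewrite invr_gt0.
move=> /(_ _ ddelta0)[I [U [cover diamU cost]]].
case/andP: ddelta0 => d0 _.
have := cover_cost_ge d0 scale cover diamU cost; lra.
Qed.

End IntermediateDimensionBounds.

(** * Strict inequalities for the limit superior *)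

Section LimitSuperior.
Variable R : realType.
Implicit Types u : nat -> R.

Lemma lee_all_gt (x y : \bar R) :
  (forall t : R, (y < t%:E)%E -> (x <= t%:E)%E) -> (x <= y)%E.
Proof.
case: y => [y| |] x_le; last 2 first.
- exact: leey.
- case: x x_le => [x| |] x_le //; last first.
    have : (+oo <= (0 : R)%:E)%E by apply: x_le; exact: ltNyr.
    by rewrite leye_eq.
  have : (x%:E <= (x - 1)%:E)%E by apply: x_le; exact: ltNyr.
  by rewrite lee_fin lerBrDr gerDl ler10.
apply/lee_addgt0Pr => e e_gt0; rewrite -EFinD; apply: x_le.
by rewrite lte_fin ltrDl.
Qed.

(** The intermediate x provides the room that absorbs subexponential factors. *)
Lemma limn_esup_lt_eventually u (t : R) :
  (limn_esup (fun n => (u n)%:E) < t%:E)%E ->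
  exists2 x, x < t & exists N, forall n, (N <= n)%N -> u n <= x.
Proof.
rewrite limn_esup_lim (cvg_lim _ (@cvg_esups_inf R _))//.
move=> /ereal_inf_lt[_ [N _ <-]] suplt.
have [x [xt supx]] : exists x : R,
    x < t /\ (esups (fun n => (u n)%:E) N <= x%:E)%E.
  case: (esups _ N) suplt => [y| |] //=; rewrite ?lte_fin; first by exists y.
  by move=> _; exists (t - 1); rewrite leNye; split => //; lra.
exists x => //; exists N => n Nn; rewrite -lee_fin; apply: le_trans supx.
by apply: ereal_sup_ubound; exists n.
Qed.

Lemma lt_limn_esup_frequently u (t : R) :
  (t%:E < limn_esup (fun n => (u n)%:E))%E ->
  exists2 x, t < x & forall N, exists2 n, (N <= n)%N & x < u n.
Proof.
move=> tu; pose l := limn_esup (fun n => (u n)%:E).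
have [x [tx xl]] : exists x : R, t < x /\ (x%:E < l)%E.
  rewrite -/l in tu; case: l tu => [y| |] //=; rewrite ?lte_fin => ty.
    by exists ((t + y) / 2); rewrite lte_fin; lra.
  by exists (t + 1); rewrite ltry; split => //; lra.
exists x => // N; have : (x%:E < esups (fun n => (u n)%:E) N)%E.
  apply: lt_le_trans xl _; rewrite /l limn_esup_lim.
  rewrite (cvg_lim _ (@cvg_esups_inf R _))//; apply: ereal_inf_lbound.
  by exists N.
by move=> /ereal_sup_gt[_ [n /= Nn <-]]; rewrite lte_fin => xu; exists n.
Qed.

End LimitSuperior.

(** * The intermediate dimension *)

Theorem theorem4p2 (R : realType) (a : nat -> R)
  (a_pos : forall n : nat, (1 <= n)%N -> 0 < a n)
  (a_noninc : forall m n : nat, (1 <= m)%N -> (m <= n)%N -> a n <= a m)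
  (a_sum1 : (fun n : nat => \sum_(1 <= i < n) a i) @ \oo --> (1 : R))
  (s_ratio : (fun n : nat =>
      (tail_average a n / tail_average a n.+1) `^ n%:R^-1) @ \oo --> (1 : R))
  (theta : R) (theta_01 : 0 < theta <= 1)
  (rho : nat -> nat)
  (rhoP : forall r : nat, (1 <= r)%N -> is_rho theta a r (rho r)) :
  upper_intermediate_dim theta (cantor_set a) =
  limn_esup (fun n : nat =>
    (- (rho n)%:R * ln 2 / ln (tail_average a (rho n)))%:E).
Proof.
apply/eqP; rewrite eq_le; apply/andP; split.
(* The bound dim <= t is shown for every real t above the limit superior; such
   t are nonnegative because the exponents are. *)
- have exponent_ge0 n : (1 <= n)%N ->
      0 <= - (rho n)%:R * ln 2 / ln (tail_average a (rho n)).
    move=> n_gt0; rewrite mulNr mulNr -mulrN mulr_ge0 ?mulr_ge0 ?ler0n//.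
      exact/ltW/ln2_gt0.
    by rewrite oppr_ge0 invr_le0 ltW// ln_tail_average_lt0// (rho_gt0 rhoP).
  apply: lee_all_gt => t t_gt.
  have [x xt [N Nx]] := limn_esup_lt_eventually t_gt.
  have t_ge0 : 0 <= t.
    apply: le_trans (ltW xt); apply: le_trans (Nx N.+1 (leqnSn N)).
    exact: exponent_ge0.
  apply: ereal_inf_lbound.
  exists t => //; split => //; apply: admissible_of_scales => //.
  move=> eps eps_gt0.
  exact: (cheap_covering_level a_pos a_sum1 s_ratio theta_01 rhoP t_ge0 xt
    eps_gt0 Nx).
- apply: le_ereal_inf_tmp => _ [t [t_ge0 t_adm] <-].
  rewrite leNgt; apply/negP => /lt_limn_esup_frequently[x tx often].
  apply: not_admissible_of_scales t_adm => //.
  exact: (mass_bound_on_scale_window a_pos a_sum1 s_ratio theta_01 rhoP t_ge0 tx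
    often).
Qed.
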